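(* Let $k\ge 2$ be fixed. For any constant $\alpha\in[\tfrac12,1)$, the complete $k$-ary tree $T_n^k$ with $n$ leaves ($n$ a power of $k$) has a rectangular layout on the integer grid with width $\Theta(n^\alpha)$ and height $\Theta(n^{1-\alpha})$.
   Context: A (strong) rectangular layout of a graph is a set of axis-parallel rectangles with pairwise disjoint interiors, one per vertex, such that two rectangles' boundaries share a segment of positive length if and only if the corresponding vertices are adjacent. On the integer grid all corners have integer coordinates; width and height are those of the smallest enclosing axis-parallel bounding box. *)

(* Defs.v *)
From HB Require Import structures.
From mathcomp Require Import all_boot all_order all_algebra.
From mathcomp Require Import all_classical all_reals all_analysis.

Set Implicit Arguments.
Unset Strict Implicit.
Unset Printing Implicit Defensive.

Import Order.TTheory GRing.Theory Num.Theory.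
Import numFieldNormedType.Exports.

Local Open Scope classical_set_scope.
Local Open Scope ring_scope.

Record rect (R : realType) := Rect {
  xmin : R;
  xmax : R;
  ymin : R;
  ymax : R;
  xmin_lt_xmax : xmin < xmax;
  ymin_lt_ymax : ymin < ymax
}.

Definition width (R : realType) (r : rect R) : R := xmax r - xmin r.

Definition height (R : realType) (r : rect R) : R := ymax r - ymin r.

Definition region (R : realType) (r : rect R) : set (R * R) :=
  `[xmin r, xmax r] `*` `[ymin r, ymax r].

Definition boundary (R : realType) (r : rect R) : set (R * R) :=
  closure (region r) `\` interior (region r).

Definition segment (R : realType) (p q : R * R) : set (R * R) :=
  [set ((1 - t) * p.1 + t * q.1, (1 - t) * p.2 + t * q.2) | t in `[0, 1]].

Definition share_segment (R : realType) (r s : rect R) : Prop :=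
  exists p q : R * R, p <> q /\ segment p q `<=` boundary r `&` boundary s.

Definition rectangular_layout (R : realType) (V : finType) (e : rel V)
    (L : V -> rect R) : Prop :=
  forall u v : V, u <> v ->
    interior (region (L u)) `&` interior (region (L v)) = set0 /\
    (share_segment (L u) (L v) <-> e u v).

Definition on_grid (R : realType) (r : rect R) : Prop :=
  [/\ xmin r \is a Num.int, xmax r \is a Num.int,
      ymin r \is a Num.int & ymax r \is a Num.int].

Definition encloses (R : realType) (V : finType) (L : V -> rect R)
    (B : rect R) : Prop :=
  forall v : V, region (L v) `<=` region B.

Definition bounding_box (R : realType) (V : finType) (L : V -> rect R)
    (B : rect R) : Prop :=
  encloses L B /\ forall B' : rect R, encloses L B' -> region B `<=` region B'.

(* A vertex of the complete k-ary tree of depth d is the word of child indices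
   read along the path from the root. *)
Definition kary_vertex (k d : nat) : finType := d.-bseq 'I_k.

Definition kary_child (k d : nat) (u v : kary_vertex k d) : bool :=
  [exists i : 'I_k, (v : seq 'I_k) == rcons u i].

Definition kary_tree (k d : nat) : rel (kary_vertex k d) :=
  fun u v => kary_child u v || kary_child v u.

Definition kary_leaf (k d : nat) (u : kary_vertex k d) : Prop :=
  forall v : kary_vertex k d, ~~ kary_child u v.

Lemma kary_leafP (k d : nat) (u : kary_vertex k d) :
  (0 < k)%N -> kary_leaf u <-> size u = d.
Proof.
case: k u => // k u _; split => [leafu|szu v].
  apply/eqP; rewrite eqn_leq size_bseq leqNgt; apply/negP => ltu.
  have szu : (size (rcons u ord0) <= d)%N by rewrite size_rcons.
  have /negP := leafu (Bseq szu); apply.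
  by apply/existsP; exists ord0.
apply/negP => /existsP[i /eqP vE].
by have := size_bseq v; rewrite vE size_rcons szu ltnn.
Qed.

Lemma card_kary_leaf (k d : nat) :
  #|[set u : kary_vertex k d | size u == d]%SET| = (k ^ d)%N.
Proof.
have szt (t : d.-tuple 'I_k) : (size t <= d)%N by rewrite size_tuple.
pose f (t : d.-tuple 'I_k) : kary_vertex k d := Bseq (szt t).
have f_inj : injective f by move=> s t [st]; apply: val_inj.
rewrite -[k in RHS]card_ord -card_tuple -(card_imset predT f_inj).
apply: eq_card => u; rewrite inE; apply/idP/imsetP => [szu|[t _ ->]].
  by exists (Tuple szu) => //; apply: val_inj.
by rewrite /= size_tuple.
Qed.

(* Main.v *)
(* Attach to every tree a box whose root contains the top-left unit cell and
   whose other rectangles stay at distance at least 1 from the top and left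
   sides. Such boxes can be hung, with unit gaps, below a horizontal strip of
   height 1 or to the right of a vertical strip of width 1, the strip being the
   new root. One step multiplies one dimension of the box by about [k] and adds
   1 to the other one. Interleaving the two kinds of steps evenly, with a
   proportion [alpha] of the first kind, the added 1's only contribute a
   convergent geometric series of relative errors. *)
Require Import Defs.
From HB Require Import structures.
From mathcomp Require Import all_boot all_order all_algebra.
From mathcomp Require Import all_classical all_reals all_analysis.
From mathcomp Require Import zify ring lra.

Set Implicit Arguments.
Unset Strict Implicit.
Unset Printing Implicit Defensive.

Import Order.TTheory GRing.Theory Num.Theory.
Import numFieldNormedType.Exports.

(** * Interval combinatorics of the construction, one axis at a time *)

Section Combinatorics.
Variable k : nat.
Implicit Types (m : nat -> bool) (d : nat) (a b : nat * nat) (u v : seq 'I_k).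
Local Open Scope nat_scope.

(* [m d] says whether the [k] subtrees of depth [d] below a vertex are placed
   next to each other in the direction under consideration; in the other
   direction they are all placed at the same coordinate. *)
Fixpoint extent m d : nat :=
  if d is d'.+1 then (if m d' then k else 1) * (extent m d').+1 else 1.

Definition transverse m : nat -> bool := fun d => ~~ m d.

Lemma transverseK : involutive transverse.
Proof. by move=> m; apply/funext => d; rewrite /transverse negbK. Qed.

Definition translate c a : nat * nat := (c + a.1, c + a.2).

(** The leading 1 keeps the subtrees off the zero side; across the split direction it is the
    thickness of the root strip. The stride [(extent m d).+1] leaves a unit gap between consecutive
    subtrees. *)
Definition offset m d (i : nat) : nat :=
  if m d then (i * (extent m d).+1).+1 else 1.

(* Projection of the rectangle of a vertex on one axis; the projection on the
   other axis is given by the complementary [m]. *)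
Fixpoint axis_span m d u : nat * nat :=
  match d, u with
  | d'.+1, [::] => (0, if m d' then extent m d else 1)
  | d'.+1, i :: u' => translate (offset m d' i) (axis_span m d' u')
  | 0, _ => (0, 1)
  end.

(** Strictness makes such spans disjoint as closed intervals, so that the rectangles do not even
    meet at a corner. *)
Definition apart a b := (a.2 < b.1) || (b.2 < a.1).
Definition overlap a b := (a.1 < b.2) && (b.1 < a.2).
Definition abut a b := (a.2 == b.1) || (b.2 == a.1).

(** Stated on bare words, without the depth bound, so that an induction can strip a common first
    letter. *)
Definition tree_adjacent u v : bool :=
  (prefix u v && (size v == (size u).+1)) ||
  (prefix v u && (size u == (size v).+1)).

Lemma apart_sym a b : apart a b = apart b a.
Proof. by rewrite /apart orbC. Qed.

Lemma overlap_sym a b : overlap a b = overlap b a.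
Proof. by rewrite /overlap andbC. Qed.

Lemma abut_sym a b : abut a b = abut b a.
Proof. by rewrite /abut orbC. Qed.

Lemma tree_adjacent_sym u v : tree_adjacent u v = tree_adjacent v u.
Proof. by rewrite /tree_adjacent orbC. Qed.

Lemma apart_translate c a b : apart (translate c a) (translate c b) = apart a b.
Proof. by rewrite /apart /= !ltn_add2l. Qed.

Lemma overlap_translate c a b : overlap (translate c a) (translate c b) = overlap a b.
Proof. by rewrite /overlap /= !ltn_add2l. Qed.

Lemma abut_translate c a b : abut (translate c a) (translate c b) = abut a b.
Proof. by rewrite /abut /= !eqn_add2l. Qed.

Lemma tree_adjacent_cons i u v : tree_adjacent (i :: u) (i :: v) = tree_adjacent u v.
Proof. by rewrite /tree_adjacent !prefix_cons eqxx. Qed.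

Lemma tree_adjacent_nil_cons i u : tree_adjacent [::] (i :: u) = (u == [::]).
Proof. by case: u. Qed.

Lemma extent_gt0 m d : 0 < k -> 0 < extent m d.
Proof. by case: d => //= d k0; case: (m d); rewrite ?muln_gt0 ?k0. Qed.

Lemma axis_span_lt m d u : 0 < k -> (axis_span m d u).1 < (axis_span m d u).2.
Proof.
move=> k0; elim: d u => [|d IH] [|i u] //=; last by rewrite ltn_add2l.
by case: (m d) => //; rewrite muln_gt0 k0.
Qed.

Lemma offset_bound m d (i : 'I_k) : offset m d i + extent m d <= extent m d.+1.
Proof.
rewrite /offset /=; case: (m d); last by lia.
by have := ltn_ord i; nia.
Qed.

Lemma axis_span_le m d u : (axis_span m d u).2 <= extent m d.
Proof.
elim: d u => [|d IH] [|i u] //=; first by case: (m d); lia.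
by apply: leq_trans (offset_bound m d i); rewrite leq_add2l.
Qed.

Lemma axis_span_nil m d : (axis_span m d [::]).1 = 0.
Proof. by case: d. Qed.

Lemma axis_span_ge1 m d u : size u <= d -> u != [::] -> 0 < (axis_span m d u).1.
Proof.
by case: d u => [|d] [|i u] //= _ _; rewrite /offset; case: (m d).
Qed.

(** Needed for the tightness of the bounding box. The root fills the extent if the top level splits
    along this axis; otherwise the first child, shifted by exactly 1, inherits a witness from the
    level below. *)
Lemma axis_span_reaches_extent m d : 0 < k ->
  exists2 u, size u <= d & (axis_span m d u).2 = extent m d.
Proof.
move=> k0; elim: d => [|d [u szu uE]]; first by exists [::].
have [md|md] := boolP (m d); first by exists [::] => //=; rewrite md.
exists (Ordinal k0 :: u) => //=.
by rewrite uE /offset (negPf md) mul1n.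
Qed.

Lemma apart_siblings m d (i j : 'I_k) a b : m d -> i < j ->
  a.2 <= extent m d ->
  apart (translate (offset m d i) a) (translate (offset m d j) b).
Proof. by rewrite /apart /offset /= => -> ij ?; apply/orP; left; nia. Qed.

(** Across the split direction the root strip is [0, 1] and the subtrees start at 1: the root of a
    subtree begins exactly there, its other vertices at 2 or later by [axis_span_ge1]. *)
Lemma axis_span_root_child m d (i : 'I_k) v : 0 < k -> size v <= d -> m d ->
  if v == [::] then
    overlap (axis_span m d.+1 [::]) (axis_span m d.+1 (i :: v)) &&
    abut (axis_span (transverse m) d.+1 [::]) (axis_span (transverse m) d.+1 (i :: v))
  else apart (axis_span (transverse m) d.+1 [::]) (axis_span (transverse m) d.+1 (i :: v)).
Proof.
move=> k0 szv md.
have := axis_span_lt m d v k0; have := axis_span_le m d v.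
have := offset_bound m d i.
case: eqP => [->|/eqP v0] /=.
  rewrite /overlap /abut /= !axis_span_nil /transverse md /offset /= md /=.
  by lia.
have := axis_span_ge1 (transverse m) szv v0.
by rewrite /apart /= /transverse md /offset /= md /=; lia.
Qed.

Lemma axis_span_root_spec m d (i : 'I_k) v : 0 < k -> size v <= d ->
  if v == [::] then
    overlap (axis_span m d.+1 [::]) (axis_span m d.+1 (i :: v)) &&
    abut (axis_span (transverse m) d.+1 [::]) (axis_span (transverse m) d.+1 (i :: v)) ||
    abut (axis_span m d.+1 [::]) (axis_span m d.+1 (i :: v)) &&
    overlap (axis_span (transverse m) d.+1 [::]) (axis_span (transverse m) d.+1 (i :: v))
  else apart (axis_span m d.+1 [::]) (axis_span m d.+1 (i :: v)) ||
    apart (axis_span (transverse m) d.+1 [::]) (axis_span (transverse m) d.+1 (i :: v)).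
Proof.
move=> k0 szv; have [md|md] := boolP (m d).
  have := axis_span_root_child i k0 szv md.
  by case: (v == [::]) => ->; rewrite ?orbT.
(* When the level splits along the other axis, the two axes exchange roles. *)
have := axis_span_root_child i k0 szv (m := transverse m) md; rewrite transverseK.
by case: (v == [::]) => [|->//]; rewrite andbC => ->; rewrite orbT.
Qed.

(** A common first letter is a common translation, distinct first letters are separated along the
    axis that splits, and an empty word is the root case. *)
Lemma axis_span_spec m d u v : 0 < k -> size u <= d -> size v <= d -> u != v ->
  if tree_adjacent u v then
    (overlap (axis_span m d u) (axis_span m d v) && abut (axis_span (transverse m) d u) (axis_span (transverse m) d v)) ||
    (abut (axis_span m d u) (axis_span m d v) && overlap (axis_span (transverse m) d u) (axis_span (transverse m) d v))
  else apart (axis_span m d u) (axis_span m d v) || apart (axis_span (transverse m) d u) (axis_span (transverse m) d v).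
Proof.
move=> k0 szu szv uv.
elim: d u v szu szv uv => [|d IH] [|i u] [|j v] // szu szv uv.
- by rewrite tree_adjacent_nil_cons; apply: axis_span_root_spec.
- rewrite tree_adjacent_sym tree_adjacent_nil_cons ![apart (axis_span _ _ (_ :: _)) _]apart_sym.
  rewrite ![abut (axis_span _ _ (_ :: _)) _]abut_sym.
  rewrite ![overlap (axis_span _ _ (_ :: _)) _]overlap_sym.
  exact: axis_span_root_spec.
have [ij|ij] := eqVneq i j.
  rewrite -ij tree_adjacent_cons /= !apart_translate !abut_translate !overlap_translate.
  apply: IH => //; by move: uv; rewrite ij eqseq_cons eqxx.
have -> : tree_adjacent (i :: u) (j :: v) = false.
  by rewrite /tree_adjacent !prefix_cons [j == i]eq_sym (negPf ij).
have siblings (n : nat -> bool) : n d -> apart (axis_span n d.+1 (i :: u)) (axis_span n d.+1 (j :: v)).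
  move=> nd; have [lij|lji|/val_inj ijE] := ltngtP (i : nat) j.
  - by apply: apart_siblings => //; apply: axis_span_le.
  - by rewrite apart_sym; apply: apart_siblings => //; apply: axis_span_le.
  - by rewrite ijE eqxx in ij.
by have [/siblings->//|/(siblings (transverse m))->] := boolP (m d); rewrite orbT.
Qed.

Lemma kary_treeE d (u v : kary_vertex k d) : kary_tree u v = tree_adjacent u v.
Proof.
have childE (x y : kary_vertex k d) :
    kary_child x y = prefix x y && (size y == (size x).+1).
  apply/existsP/andP => [[i /eqP->]|[/prefixP[s ->]]].
    by rewrite prefix_rcons size_rcons.
  rewrite size_cat -addn1 eqn_add2l; case: s => [|i [|//]] // _.
  by exists i; rewrite cats1.
by rewrite /kary_tree /tree_adjacent !childE.
Qed.

End Combinatorics.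

Local Open Scope classical_set_scope.
Local Open Scope ring_scope.

(** * Growth of the extents *)

Section Growth.
Context {R : realType}.
Variable k : nat.
Hypothesis k_ge2 : (2 <= k)%N.
Implicit Types (m : nat -> bool) (d : nat) (beta : R).

Definition splits m d : nat := (\sum_(j < d) m j)%N.

Let K_ge1 : 1 <= k%:R :> R. Proof. by rewrite ler1n; lia. Qed.
Let K_gt0 : 0 < k%:R :> R. Proof. by rewrite ltr0n; lia. Qed.

Lemma splitsS m d : splits m d.+1 = (splits m d + m d)%N.
Proof. by rewrite /splits big_ord_recr. Qed.

Lemma splits_transverse m d : (splits m d + splits (transverse m) d)%N = d.
Proof.
elim: d => [|d IH]; first by rewrite /splits !big_ord0.
by rewrite !splitsS addnACA IH /transverse -addn1; case: (m d).
Qed.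

Lemma extentS m d :
  (extent k m d.+1)%:R = k%:R ^+ m d * ((extent k m d)%:R + 1) :> R.
Proof. by rewrite /= natrM -natr1; case: (m d); rewrite ?expr1 ?expr0. Qed.

Lemma extent_ge m d : k%:R ^+ splits m d <= (extent k m d)%:R :> R.
Proof.
elim: d => [|d IH]; first by rewrite /splits big_ord0.
rewrite splitsS extentS exprD mulrC.
by rewrite ler_wpM2l ?exprn_ge0 ?ler0n // (le_trans IH) // lerDl.
Qed.

(* [extent / k ^ splits] grows by [k ^ - splits] at every level, and these
   increments are dominated by a geometric series of ratio [k `^ - beta]. *)
Lemma extent_le m beta : 0 < beta ->
  (forall d, beta * d%:R <= (splits m d)%:R + 1) ->
  exists2 C : R, 0 < C &
    forall d, (extent k m d)%:R <= C * k%:R ^+ splits m d.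
Proof.
move=> beta0 splits_ge.
pose q : R := (k%:R `^ beta)^-1.
have q0 : 0 < q by rewrite invr_gt0 powR_gt0.
have q1 : q < 1.
  rewrite invf_lt1 ?powR_gt0 //.
  have pow1 : 1 `^ beta = 1 :> R by rewrite powR1.
  rewrite -[ltLHS]pow1 gt0_ltr_powR ?nnegrE ?ler01 ?ler0n //.
  by rewrite ltr1n.
(* This is 1 plus [k] times the first [d] terms of the geometric series of [q]; the factor [k]
   absorbs the additive 1 in the lower bound on [splits]. *)
pose A d : R := 1 + k%:R * (1 - q ^+ d) / (1 - q).
have AS d : A d.+1 = A d + k%:R * q ^+ d.
  rewrite /A exprS; field; by rewrite subr_eq0 eq_sym lt_eqF.
have incr d : 1 <= k%:R ^+ splits m d * (k%:R * q ^+ d).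
  rewrite mulrA -exprSr /q exprVn ler_pdivlMr ?exprn_gt0 ?powR_gt0 // mul1r.
  rewrite -[leLHS]powR_mulrn ?powR_ge0 // -powRrM.
  rewrite -[leRHS]powR_mulrn ?ler0n //.
  by apply: ler_powR => //; rewrite -natr1.
have bound d : (extent k m d)%:R <= A d * k%:R ^+ splits m d.
  elim: d => [|d IH].
    by rewrite /A /splits big_ord0 expr0 subrr mulr0 mul0r addr0 mulr1.
  rewrite splitsS extentS AS addnC exprD mulrCA ler_wpM2l ?exprn_ge0 ?ler0n //.
  by rewrite mulrDl lerD // mulrC.
have C0 : 0 < 1 + k%:R / (1 - q) by rewrite ltr_wpDr // divr_ge0 ?ler0n; lra.
exists (1 + k%:R / (1 - q)) => // d.
apply: (le_trans (bound d)); rewrite ler_wpM2r ?exprn_ge0 ?ler0n // lerD2l.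
rewrite ler_pM2r ?invr_gt0 ?subr_gt0 // ler_piMr ?ler0n // gerBl.
by rewrite exprn_ge0 // ltW.
Qed.

Lemma extent_Theta m beta : 0 < beta ->
  (forall d, `|(splits m d)%:R - beta * d%:R| <= 1) ->
  (fun d : nat => (extent k m d)%:R : R^o) =Theta_\oo
    (fun d : nat => (k ^ d)%:R `^ beta : R^o).
Proof.
move=> beta0 splitsP.
have [d|C C0 leC] := extent_le beta0 (m := m).
  by have := splitsP d; rewrite ler_norml => /andP[]; lra.
have powE d : (k ^ d)%:R `^ beta = k%:R `^ (beta * d%:R) :> R.
  by rewrite natrX -powR_mulrn ?ler0n // -powRrM mulrC.
have split_le d : k%:R ^+ splits m d <= k%:R * (k ^ d)%:R `^ beta :> R.
  have -> : k%:R * (k ^ d)%:R `^ beta = k%:R `^ (1 + beta * d%:R) :> R.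
    by rewrite powE powRD ?powRr1 ?ler0n // (gt_eqF K_gt0) implybT.
  rewrite -powR_mulrn ?ler0n //; apply: ler_powR => //.
  by have := splitsP d; rewrite ler_norml => /andP[]; lra.
have split_ge d : (k ^ d)%:R `^ beta <= k%:R * k%:R ^+ splits m d :> R.
  rewrite -exprS -powR_mulrn ?ler0n // powE.
  apply: ler_powR => //; rewrite -natr1.
  by have := splitsP d; rewrite ler_norml => /andP[]; lra.
(* An error of at most 1 in the exponent costs a factor [k] on either side; [C] comes from the
   geometric series. *)
rewrite eqThetaE; apply/asboolP; exists (k%:R^-1, C * k%:R).
  by rewrite /= invr_gt0 K_gt0 mulr_gt0.
near=> d; rewrite /= !ger0_norm ?powR_ge0 ?ler0n //; split.
  rewrite mulrC ler_pdivrMr // (le_trans (split_ge d)) //.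
  by rewrite mulrC ler_wpM2r ?ler0n ?extent_ge.
rewrite (le_trans (leC d)) // -mulrA ler_wpM2l // ltW //.
Unshelve. all: by end_near.
Qed.

End Growth.

(** * Even interleaving of the two kinds of steps *)

Section Greedy.
Context {R : realType}.
Variable alpha : R.

(* The number of horizontal splits among the lowest [d] levels, namely
   [floor (alpha * d)]. *)
Fixpoint greedy d : nat :=
  if d is d'.+1
  then (greedy d' + ((greedy d').+1%:R <= alpha * d%:R :> R)%R)%N else 0%N.

(** For [0 <= alpha < 1] this is the mechanical word of slope [alpha]: it marks the levels at which
    the floor of [alpha * d] jumps. *)
Definition greedy_split d : bool := (greedy d).+1%:R <= alpha * d.+1%:R.

Lemma splits_greedy d : splits greedy_split d = greedy d.
Proof.
by elim: d => [|d IH]; rewrite ?splitsS ?IH // /splits big_ord0.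
Qed.

(** As [alpha * d] rises by less than 1 per level and never decreases, adding at most one unit keeps
    up with its floor. *)
Lemma greedy_floor d : 0 <= alpha < 1 ->
  (greedy d)%:R <= alpha * d%:R < (greedy d)%:R + 1.
Proof.
move=> /andP[alpha0 alpha1].
elim: d => [|d /andP[IHl IHr]]; first by rewrite /= mulr0 add0r lexx ltr01.
rewrite [greedy d.+1]/=; case: (leP (greedy d).+1%:R) => ad.
  rewrite addn1 ad /=; rewrite -!natr1 in ad *; lra.
rewrite addn0 natr1 ad andbT (le_trans IHl) // ler_wpM2l // ler_nat //.
Qed.

End Greedy.

(** * Planar rectangles and shared boundary segments *)

Section Geometry.
Context {R : realType}.
Implicit Types (r s : rect R) (p : R * R).

Lemma regionE r p :
  region r p <-> (xmin r <= p.1 <= xmax r) /\ (ymin r <= p.2 <= ymax r).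
Proof. by rewrite /region /= !in_itv. Qed.

(** A neighbourhood of [p] contains a product of neighbourhoods, whose slices through [p] reduce the
    claim to interiors of intervals. *)
Lemma interior_region r p :
  (region r)° p -> (xmin r < p.1 < xmax r) /\ (ymin r < p.2 < ymax r).
Proof.
case=> -[A B] [/= pA pB] AB.
have : `[xmin r, xmax r]° p.1.
  apply: filterS pA => x Ax.
  by have [] := AB (x, p.2) (conj Ax (nbhs_singleton pB)).
have : `[ymin r, ymax r]° p.2.
  apply: filterS pB => y By.
  by have [] := AB (p.1, y) (conj (nbhs_singleton pA) By).
by rewrite !interior_itv /= !in_itv.
Qed.

Lemma closed_region r : closed (region r).
Proof.
have -> : region r =
    fst @^-1` `[xmin r, xmax r] `&` snd @^-1` `[ymin r, ymax r] by [].
by apply: closedI; apply: preimage_closed => [p _|];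
  [exact: cvg_fst|exact: itv_closed|exact: cvg_snd|exact: itv_closed].
Qed.

Lemma boundaryE r : boundary r = region r `\` (region r)°.
Proof. by rewrite /boundary -(closure_id (region r)).1 //; apply: closed_region. Qed.

Lemma segment_left (p q : R * R) : segment p q p.
Proof.
by exists 0; rewrite /= ?in_itv /= ?lexx ?ler01 // subr0 !mul1r !mul0r !addr0;
  case: p.
Qed.

Lemma share_segment_sym r s : share_segment r s -> share_segment s r.
Proof. by case=> p [q [pq sub]]; exists p, q; rewrite setIC. Qed.

Lemma share_segment_meet r s : share_segment r s ->
  region r `&` region s !=set0.
Proof.
case=> p [q [_ /(_ _ (segment_left p q))]]; rewrite !boundaryE.
by move=> [[rp _] [sp _]]; exists p.
Qed.

Lemma share_segment_horizontal r s : ymax r = ymin s ->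
  xmin r < xmax s -> xmin s < xmax r -> share_segment r s.
Proof.
move=> rs lt1 lt2.
have r_lt := xmin_lt_xmax r; have s_lt := xmin_lt_xmax s.
have r_lt' := ymin_lt_ymax r; have s_lt' := ymin_lt_ymax s.
(* The shared segment lies on the common side, above the intersection of the two ranges of
   abscissas. *)
pose a := Num.max (xmin r) (xmin s); pose b := Num.min (xmax r) (xmax s).
have ab : a < b by rewrite /a /b lt_min !gt_max r_lt s_lt lt1 lt2.
have ra : xmin r <= a by rewrite le_max lexx.
have sa : xmin s <= a by rewrite le_max lexx orbT.
have br : b <= xmax r by rewrite ge_min lexx.
have bs : b <= xmax s by rewrite ge_min lexx orbT.
exists (a, ymax r), (b, ymax r); split; first by case=> abE; rewrite abE ltxx in ab.
move=> _ [t /= + <-]; rewrite in_itv /= => /andP[t0 t1].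
have ax : a <= (1 - t) * a + t * b by nra.
have xb : (1 - t) * a + t * b <= b by nra.
rewrite -mulrDl subrK mul1r !boundaryE; split; split.
- by apply/regionE => /=; split; apply/andP; split; lra.
- by move=> /interior_region /= [_]; rewrite ltxx andbF.
- by apply/regionE => /=; split; apply/andP; split; lra.
- by move=> /interior_region /= [_]; rewrite rs ltxx.
Qed.

Lemma share_segment_vertical r s : xmax r = xmin s ->
  ymin r < ymax s -> ymin s < ymax r -> share_segment r s.
Proof.
move=> rs lt1 lt2.
have r_lt := ymin_lt_ymax r; have s_lt := ymin_lt_ymax s.
have r_lt' := xmin_lt_xmax r; have s_lt' := xmin_lt_xmax s.
pose a := Num.max (ymin r) (ymin s); pose b := Num.min (ymax r) (ymax s).
have ab : a < b by rewrite /a /b lt_min !gt_max r_lt s_lt lt1 lt2.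
have ra : ymin r <= a by rewrite le_max lexx.
have sa : ymin s <= a by rewrite le_max lexx orbT.
have br : b <= ymax r by rewrite ge_min lexx.
have bs : b <= ymax s by rewrite ge_min lexx orbT.
exists (xmax r, a), (xmax r, b); split; first by case=> abE; rewrite abE ltxx in ab.
move=> _ [t /= + <-]; rewrite in_itv /= => /andP[t0 t1].
have ax : a <= (1 - t) * a + t * b by nra.
have xb : (1 - t) * a + t * b <= b by nra.
rewrite -mulrDl subrK mul1r !boundaryE; split; split.
- by apply/regionE => /=; split; apply/andP; split; lra.
- by move=> /interior_region /= [+ _]; rewrite ltxx andbF.
- by apply/regionE => /=; split; apply/andP; split; lra.
- by move=> /interior_region /= [+ _]; rewrite rs ltxx.
Qed.

Lemma interior_disjoint r s :
  [|| xmax r <= xmin s, xmax s <= xmin r, ymax r <= ymin s | ymax s <= ymin r] ->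
  (region r)° `&` (region s)° = set0.
Proof.
move=> rs; apply/seteqP; split=> // p [/interior_region + /interior_region].
move=> [/andP[? ?] /andP[? ?]] [/andP[? ?] /andP[? ?]].
by case/or4P: rs => ?; lra.
Qed.

End Geometry.

(** * From spans to the layout and its bounding box *)

Section Layout.
Variables (R : realType) (k : nat) (m : nat -> bool).
Hypothesis k_gt0 : (0 < k)%N.
Implicit Types (d : nat) (a b : nat * nat).

Definition span_rect a b (ha : (a.1 < a.2)%N) (hb : (b.1 < b.2)%N) : rect R :=
  @Rect R a.1%:R a.2%:R b.1%:R b.2%:R
    (eq_ind_r is_true ha (ltr_nat R _ _)) (eq_ind_r is_true hb (ltr_nat R _ _)).

Lemma span_rect_touching a b a' b' ha hb ha' hb' :
  (overlap a a' && abut b b') || (abut a a' && overlap b b') ->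
  let r := @span_rect a b ha hb in let s := @span_rect a' b' ha' hb' in
  (region r)° `&` (region s)° = set0 /\ share_segment r s.
Proof.
move=> touch r s; split.
  apply: interior_disjoint; rewrite /= !ler_nat.
  by move: touch; rewrite /overlap /abut; lia.
case/orP: touch => /andP[].
  move=> /andP[lt1 lt2] /orP[] /eqP bE.
    by apply: share_segment_horizontal; rewrite /= ?ltr_nat ?bE.
  by apply/share_segment_sym/share_segment_horizontal; rewrite /= ?ltr_nat ?bE.
move=> /orP[] /eqP aE /andP[lt1 lt2].
  by apply: share_segment_vertical; rewrite /= ?ltr_nat ?aE.
by apply/share_segment_sym/share_segment_vertical; rewrite /= ?ltr_nat ?aE.
Qed.

Lemma span_rect_apart a b a' b' ha hb ha' hb' :
  apart a a' || apart b b' ->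
  let r := @span_rect a b ha hb in let s := @span_rect a' b' ha' hb' in
  (region r)° `&` (region s)° = set0 /\ ~ share_segment r s.
Proof.
move=> far r s; split.
  by apply: interior_disjoint; rewrite /= !ler_nat; move: far; rewrite /apart; lia.
move=> /share_segment_meet [p [/regionE/= + /regionE/=]].
move=> [/andP[? ?] /andP[? ?]] [/andP[? ?] /andP[? ?]].
have lt_abs (i j : nat) (x : R) : (i < j)%N -> x <= i%:R -> j%:R <= x -> False.
  by rewrite -(ltr_nat R); lra.
by case/orP: far => /orP[] /lt_abs; apply; eassumption.
Qed.

Definition tree_layout d (v : kary_vertex k d) : rect R :=
  span_rect (axis_span_lt m d v k_gt0) (axis_span_lt (transverse m) d v k_gt0).

Definition tree_box d : rect R :=
  span_rect (a := (0, extent k m d)%N) (b := (0, extent k (transverse m) d)%N)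
    (extent_gt0 m d k_gt0) (extent_gt0 (transverse m) d k_gt0).

Lemma tree_layout_rectangular d :
  rectangular_layout (@kary_tree k d) (@tree_layout d).
Proof.
move=> u v uv; rewrite kary_treeE.
have /(axis_span_spec m k_gt0 (size_bseq u) (size_bseq v)) : (u : seq 'I_k) != v.
  by apply: contra_not_neq uv => /val_inj.
case: (tree_adjacent u v) => spec.
  by have [] := span_rect_touching (axis_span_lt m d u k_gt0)
    (axis_span_lt (transverse m) d u k_gt0) (axis_span_lt m d v k_gt0)
    (axis_span_lt (transverse m) d v k_gt0) spec.
by have [] := span_rect_apart (axis_span_lt m d u k_gt0)
  (axis_span_lt (transverse m) d u k_gt0) (axis_span_lt m d v k_gt0)
  (axis_span_lt (transverse m) d v k_gt0) spec.
Qed.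

Lemma tree_layout_grid d (v : kary_vertex k d) : on_grid (tree_layout v).
Proof. by split; apply: natr_int. Qed.

Lemma tree_layout_box d : bounding_box (@tree_layout d) (tree_box d).
Proof.
split=> [v p /regionE/= [/andP[x1 x2] /andP[y1 y2]]|B' encl p].
  apply/regionE => /=; split; apply/andP; split.
  - exact: le_trans x1.
  - by apply: (le_trans x2); rewrite ler_nat axis_span_le.
  - exact: le_trans y1.
  - by apply: (le_trans y2); rewrite ler_nat axis_span_le.
have corners (v : kary_vertex k d) : [/\ xmin B' <= xmin (tree_layout v),
    xmax (tree_layout v) <= xmax B', ymin B' <= ymin (tree_layout v)
    & ymax (tree_layout v) <= ymax B'].
  have ltx := xmin_lt_xmax (tree_layout v).
  have lty := ymin_lt_ymax (tree_layout v).
  have /encl/regionE/= [/andP[? ?] /andP[? ?]] :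
      region (tree_layout v) (xmin (tree_layout v), ymin (tree_layout v)).
    by apply/regionE => /=; rewrite !lexx !ltW.
  have /encl/regionE/= [/andP[? ?] /andP[? ?]] :
      region (tree_layout v) (xmax (tree_layout v), ymax (tree_layout v)).
    by apply/regionE => /=; rewrite !lexx !ltW.
  by split.
(* The root attains both lower sides of the box; each upper side is attained by a vertex that may
   depend on the axis. *)
have [] := corners (Bseq (leq0n d : (size [::] <= d)%N)).
rewrite /= !axis_span_nil => x0 _ y0 _.
have [u szu uE] := axis_span_reaches_extent m d k_gt0.
have [_ /= xW _ _] := corners (Bseq szu).
have [v szv vE] := axis_span_reaches_extent (transverse m) d k_gt0.
have [_ _ _ /= yH] := corners (Bseq szv).
rewrite uE in xW; rewrite vE in yH.
move=> /regionE/= [/andP[? ?] /andP[? ?]]; apply/regionE.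
by split; apply/andP; split; lra.
Qed.

End Layout.

Theorem theorem9 (R : realType) (k : nat) (alpha : R)
    (hk : (2 <= k)%N) (halpha : 1 / 2 <= alpha < 1) :
  exists (L : forall d : nat, kary_vertex k d -> rect R) (B : nat -> rect R),
    [/\ forall d : nat, rectangular_layout (@kary_tree k d) (L d),
        forall (d : nat) (v : kary_vertex k d), on_grid (L d v),
        forall d : nat, bounding_box (L d) (B d),
        (fun d : nat => width (B d) : R^o) =Theta_\oo
          (fun d : nat => (k ^ d)%:R `^ alpha : R^o) &
        (fun d : nat => height (B d) : R^o) =Theta_\oo
          (fun d : nat => (k ^ d)%:R `^ (1 - alpha) : R^o)].
Proof.
have k_gt0 : (0 < k)%N by apply: leq_trans hk.
have [alpha0 alpha1] : 0 < alpha /\ alpha < 1 by lra.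
pose m := greedy_split alpha.
have mP d : `|(splits m d)%:R - alpha * d%:R| <= 1.
  rewrite /m splits_greedy; have /andP[] := @greedy_floor _ alpha d ltac:(lra).
  by rewrite ler_norml; lra.
(* The complementary levels number [d] minus the others, so their deviation from [(1 - alpha) * d]
   is the opposite one. *)
have m'P d : `|(splits (transverse m) d)%:R - (1 - alpha) * d%:R| <= 1.
  have /(congr1 (fun n => n%:R : R)) := splits_transverse m d.
  rewrite natrD => dE; have := mP d; rewrite distrC -dE.
  by congr (`|_| <= _); ring.
exists (@tree_layout R k m k_gt0), (@tree_box R k m k_gt0); split.
- exact: tree_layout_rectangular.
- exact: tree_layout_grid.
- exact: tree_layout_box.
- have -> : (fun d => width (tree_box R m k_gt0 d) : R^o) =
      (fun d => (extent k m d)%:R) by apply/funext => d; rewrite /width /= subr0.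
  exact: extent_Theta.
- have -> : (fun d => height (tree_box R m k_gt0 d) : R^o) =
      (fun d => (extent k (transverse m) d)%:R).
    by apply/funext => d; rewrite /height /= subr0.
  by apply: extent_Theta => //; lra.
Qed.
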